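(* Let $(M^{2m},\varphi,g)$ be a para-Kähler-Norden manifold, $TM$ its tangent bundle equipped with the $\varphi$-Sasaki metric $g^\varphi$, and $F$ a $(1,1)$-tensor field on $M$. A curve $\Gamma=(\gamma(t),\xi(t))$ on $TM$ is ${}^{H}F$-planar with respect to $\widetilde\nabla$ if and only if there are functions $\varrho_1,\varrho_2$ of the parameter $t$ such that $$\gamma_t''=R(\xi_t',\varphi\xi)\gamma_t'+\varrho_1\gamma_t'+\varrho_2F\gamma_t',\qquad \xi_t''=\varrho_1\xi_t'+\varrho_2F\xi_t' .$$
   Context: A para-Kähler-Norden manifold $(M^{2m},\varphi,g)$ is a $2m$-dimensional Riemannian manifold $(M,g)$ with a $(1,1)$-tensor field $\varphi$ such that $\varphi^2=\mathrm{id}$, $\varphi\ne\pm\mathrm{id}$, the $+1$ and $-1$ eigenbundles of $\varphi$ have equal rank, $g(\varphi X,Y)=g(X,\varphi Y)$, and $\nabla\varphi=0$, where $\nabla$ is the Levi-Civita connection of $g$. $R(X,Y)Z=\nabla_X\nabla_YZ-\nabla_Y\nabla_XZ-\nabla_{[X,Y]}Z$. Points of $TM$ are written $(x,\xi)$; ${}^{H}X$, ${}^{V}X$ are the horizontal (with respect to $\nabla$) and vertical lifts to $TM$. The $\varphi$-Sasaki metric $g^\varphi$ on $TM$ is defined by $g^\varphi({}^HX,{}^HY)=g(X,Y)$, $g^\varphi({}^HX,{}^VY)=0$, $g^\varphi({}^VX,{}^VY)=g(X,\varphi Y)$; $\widetilde\nabla$ is its Levi-Civita connection. The horizontal lift ${}^HF$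 of $F$ is the $(1,1)$-tensor field on $TM$ with ${}^HF({}^HX)={}^H(FX)$ and ${}^HF({}^VX)={}^V(FX)$. A curve $\Gamma=(\gamma(t),\xi(t))$ consists of a curve $\gamma$ on $M$ and a vector field $\xi$ along $\gamma$. Write $\gamma_t'=d\gamma/dt$, $\gamma_t''=\nabla_{\gamma_t'}\gamma_t'$, $\xi_t'=\nabla_{\gamma_t'}\xi$, $\xi_t''=\nabla_{\gamma_t'}\xi_t'$; then $\Gamma_t'={}^H\gamma_t'+{}^V\xi_t'$. $\Gamma$ is ${}^HF$-planar with respect to $\widetilde\nabla$ if $\widetilde\nabla_{\Gamma_t'}\Gamma_t'=\varrho_1\Gamma_t'+\varrho_2\,{}^HF\,\Gamma_t'$ for some functions $\varrho_1,\varrho_2$ of $t$. *)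

(* Defs.v *)
From HB Require Import structures.
From mathcomp Require Import all_boot all_order all_algebra.
From mathcomp Require Import all_classical all_reals all_analysis.

Set Implicit Arguments.
Unset Strict Implicit.
Unset Printing Implicit Defensive.

Import Order.TTheory GRing.Theory Num.Theory numFieldNormedType.Exports.

Local Open Scope classical_set_scope.
Local Open Scope ring_scope.

Fixpoint Ck (R : realType) (V W : normedModType R) (k : nat) (U : set V)
    (f : V -> W) : Prop :=
  if k is k'.+1 then
    (forall x, U x -> differentiable f x) /\
    (forall v, Ck k' U (fun x => 'D_v f x))
  else forall x, U x -> {for x, continuous f}.

Definition smooth (R : realType) (V W : normedModType R) (U : set V)
  (f : V -> W) : Prop := forall k, Ck k U f.

(* A set with an atlas modelled on E.  The manifold is the union [carrier] of
   the chart domains, inside the ambient type [mpoint]; [param i] is the inverse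
   of [coords i] on the image of the chart and is irrelevant elsewhere.  The
   axioms are in [manifold] below. *)
Record atlas (R : realType) (E : normedModType R) := Atlas {
  mpoint : Type;
  chart : Type;
  dom : chart -> set mpoint;
  coords : chart -> mpoint -> E;
  param : chart -> E -> mpoint }.

(* The components, in each chart i and at each coordinate x, of a (1,1)-tensor
   field F, as x |-> (v |-> F v), of a (0,2)-tensor field g, as
   x |-> (u, v |-> g(u,v)), and of an affine connection, whose component at
   (x, u, v) is the vector with components Gamma^k_ab(x) u^a v^b: the covariant
   derivative in the direction u of the field with constant components v.  The
   values for x outside the image of the chart i are irrelevant. *)
Definition field11 (R : realType) (E : normedModType R) (M : atlas E) : Type :=
  chart M -> E -> E -> E.

Definition field02 (R : realType) (E : normedModType R) (M : atlas E) : Type :=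
  chart M -> E -> E -> E -> R.

Definition symbols (R : realType) (E : normedModType R) (M : atlas E) : Type :=
  chart M -> E -> E -> E -> E.

Section Manifold.
Context {R : realType} {E : normedModType R}.
Variable M : atlas E.

Definition carrier : set (mpoint M) := [set p | exists i, dom i p].

Definition image_of (i : chart M) : set E := coords i @` dom i.

Definition overlap (i j : chart M) : set E := coords i @` (dom i `&` dom j).

Definition trans (i j : chart M) : E -> E := coords j \o param i.

Definition mopen (O : set (mpoint M)) : Prop :=
  O `<=` carrier /\ forall i, open (coords i @` (O `&` dom i)).

Record manifold : Prop := {
  coordsK : forall (i : chart M) p, dom i p -> param i (coords i p) = p;
  open_overlap : forall i j, open (overlap i j);
  smooth_trans : forall i j, smooth (overlap i j) (trans i j);
  hausdorff_manifold : forall p q, carrier p -> carrier q -> p <> q ->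
    exists A B, [/\ mopen A, mopen B, A p, B q & A `&` B = set0];
  second_countable_manifold : exists B : nat -> set (mpoint M),
    (forall k, mopen (B k)) /\
    (forall O p, mopen O -> O p -> exists k, B k p /\ B k `<=` O) }.

(* A tangent vector at p is the family of its components in the charts around
   p (set to 0 in the other charts, so that the family is determined by the
   vector). *)
Definition tangent (p : mpoint M) (v : chart M -> E) : Prop :=
  (forall i, ~ dom i p -> v i = 0) /\
  (forall i j, dom i p -> dom j p -> v j = 'D_(v i) (trans i j) (coords i p)).

Record tensor11 (F : field11 M) : Prop := {
  tensor11_linear : forall i x, image_of i x -> linear (F i x);
  tensor11_smooth : forall i v, smooth (image_of i) (fun x => F i x v);
  tensor11_trans : forall i j x v, overlap i j x ->
    'D_(F i x v) (trans i j) x = F j (trans i j x) ('D_v (trans i j) x) }.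

Record riemannian (g : field02 M) : Prop := {
  riemannian_linear : forall i x u, image_of i x -> scalar (g i x u);
  riemannian_sym : forall i x u v, image_of i x -> g i x u v = g i x v u;
  riemannian_pos : forall i x u, image_of i x -> u <> 0 -> 0 < g i x u u;
  riemannian_smooth : forall i u v, smooth (image_of i) (fun x => g i x u v);
  riemannian_trans : forall i j x u v, overlap i j x ->
    g i x u v = g j (trans i j x) ('D_u (trans i j) x) ('D_v (trans i j) x) }.

Record connection (nabla : symbols M) : Prop := {
  connection_linearl : forall i x v, image_of i x -> linear (nabla i x ^~ v);
  connection_linearr : forall i x u, image_of i x -> linear (nabla i x u);
  connection_smooth : forall i u v,
    smooth (image_of i) (fun x => nabla i x u v);
  connection_trans : forall i j x u v, overlap i j x ->
    'D_(nabla i x u v) (trans i j) x =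
    'D_u (fun y => 'D_v (trans i j) y) x +
    nabla j (trans i j x) ('D_u (trans i j) x) ('D_v (trans i j) x) }.

Record levi_civita (g : field02 M) (nabla : symbols M) : Prop := {
  levi_civita_connection : connection nabla;
  levi_civita_torsionfree : forall i x u v, image_of i x ->
    nabla i x u v = nabla i x v u;
  levi_civita_metric : forall i x w u v, image_of i x ->
    'D_w (fun y => g i y u v) x =
    g i x (nabla i x w u) v + g i x u (nabla i x w v) }.

Section Derivatives.
Variable nabla : symbols M.

(* Operations on vector fields written in the chart i. *)
Definition cov (i : chart M) (X Y : E -> E) : E -> E :=
  fun x => 'D_(X x) Y x + nabla i x (X x) (Y x).

Definition bracket (X Y : E -> E) : E -> E :=
  fun x => 'D_(X x) Y x - 'D_(Y x) X x.

Definition curvature_field (i : chart M) (X Y Z : E -> E) : E -> E :=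
  fun x => cov i X (cov i Y Z) x - cov i Y (cov i X Z) x
           - cov i (bracket X Y) Z x.

(* R(u,v)w for vectors u, v, w at x: as R is tensorial, the vectors may be
   extended to fields with constant components. *)
Definition curvature (i : chart M) (x u v w : E) : E :=
  curvature_field i (fun=> u) (fun=> v) (fun=> w) x.

Definition parallel11 (F : field11 M) : Prop :=
  forall i x u v, image_of i x ->
    cov i (fun=> u) (fun y => F i y v) x =
    F i x (cov i (fun=> u) (fun=> v) x).

Definition smooth_curve (J : set R) (c : R -> mpoint M) : Prop :=
  [/\ forall t, J t -> carrier (c t),
      forall O, mopen O -> open (J `&` c @^-1` O) &
      forall i, smooth (J `&` c @^-1` dom i) (coords i \o c)].

(* Vector fields along a curve are given by their components X i t, relevant
   when the chart i contains the point of parameter t. *)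
Definition velocity (c : R -> mpoint M) (i : chart M) (t : R) : E :=
  derive1 (coords i \o c) t.

Definition cov_along (c : R -> mpoint M) (X : chart M -> R -> E)
    (i : chart M) (t : R) : E :=
  derive1 (X i) t + nabla i (coords i (c t)) (velocity c i t) (X i t).

Definition planar (F : field11 M) (J : set R) (c : R -> mpoint M) : Prop :=
  exists rho1 rho2 : R -> R, forall t, J t -> forall i, dom i (c t) ->
    cov_along c (velocity c) i t =
    rho1 t *: velocity c i t +
    rho2 t *: F i (coords i (c t)) (velocity c i t).

End Derivatives.

(* The tangent bundle, with the charts induced by those of M: the pair (p,v)
   has the coordinates of p and the components of v.  Its carrier consists of
   the pairs (p,v) with v tangent at p. *)
Definition tangent_bundle : atlas (E * E)%type := {|
  mpoint := (mpoint M * (chart M -> E))%type;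
  chart := chart M;
  dom := fun i => [set q | dom i q.1 /\ tangent q.1 q.2];
  coords := fun i q => (coords i q.1, q.2 i);
  param := fun i z => (param i z.1, fun j =>
    if `[< dom j (param i z.1) >] then 'D_(z.2) (trans i j) z.1 else 0) |}.

Definition base_curve (c : R -> mpoint tangent_bundle) : R -> mpoint M :=
  fun t => (c t).1.

Definition fibre_field (c : R -> mpoint tangent_bundle) : chart M -> R -> E :=
  fun i t => (c t).2 i.

Section Lifts.
Variable nabla : symbols M.

(* Lifts of X to the tangent vectors at the point of coordinates z. *)
Definition hlift (i : chart M) (z : E * E) (X : E) : E * E :=
  (X, - nabla i z.1 X z.2).

Definition vlift (X : E) : E * E := (0, X).

(* The connection map: a = hlift i z a.1 + vlift (vpart i z a). *)
Definition vpart (i : chart M) (z a : E * E) : E := a.2 + nabla i z.1 a.1 z.2.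

Definition phi_sasaki (phi : field11 M) (g : field02 M)
    (i : chart tangent_bundle) (z a b : E * E) : R :=
  g i z.1 a.1 b.1 + g i z.1 (vpart i z a) (phi i z.1 (vpart i z b)).

Definition hlift11 (F : field11 M) (i : chart tangent_bundle)
    (z a : E * E) : E * E :=
  hlift i z (F i z.1 a.1) + vlift (F i z.1 (vpart i z a)).

End Lifts.
End Manifold.

Section LiftTheory.
Context {R : realType} {E : normedModType R} {M : atlas E}.
Variables (nabla : symbols M) (g : field02 M).
Variables (phi F : field11 M) (i : chart M) (z : E * E).
Hypotheses (nablaP : connection nabla) (gP : riemannian g).
Hypotheses (phiP : tensor11 phi) (FP : tensor11 F) (zP : image_of i z.1).

Let linear0 (U W : lmodType R) (f : U -> W) : linear f -> f 0 = 0.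
Proof.
move=> lf; have := lf (-1) 0 0.
by rewrite scaler0 addr0 scaleN1r addNr.
Qed.

Let scalar0 (U : lmodType R) (f : U -> R) : scalar f -> f 0 = 0.
Proof.
move=> lf; have := lf (-1) 0 0.
by rewrite scaler0 addr0 mulN1r addNr.
Qed.

Lemma lift_decomp a : a = hlift nabla i z a.1 + vlift (vpart nabla i z a).
Proof.
case: a => a b; rewrite /hlift /vlift /vpart /=.
by congr pair; rewrite /= ?addr0// addrC addrK.
Qed.

Lemma vpart_hlift X : vpart nabla i z (hlift nabla i z X) = 0.
Proof. by rewrite /vpart /= addNr. Qed.

Lemma vpart_vlift X : vpart nabla i z (vlift X) = X.
Proof.
by rewrite /vpart /= (linear0 (connection_linearl nablaP z.2 zP)) addr0.
Qed.

Lemma phi_sasakiHH X Y :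
  phi_sasaki nabla phi g i z (hlift nabla i z X) (hlift nabla i z Y) =
  g i z.1 X Y.
Proof.
rewrite /phi_sasaki !vpart_hlift /= (linear0 (tensor11_linear phiP zP)).
by rewrite (scalar0 (riemannian_linear gP 0 zP)) addr0.
Qed.

Lemma phi_sasakiHV X Y :
  phi_sasaki nabla phi g i z (hlift nabla i z X) (vlift Y) = 0.
Proof.
rewrite /phi_sasaki vpart_hlift vpart_vlift /= (riemannian_sym gP 0 _ zP).
by rewrite !(scalar0 (riemannian_linear gP _ zP)) addr0.
Qed.

Lemma phi_sasakiVV X Y :
  phi_sasaki nabla phi g i z (vlift X) (vlift Y) = g i z.1 X (phi i z.1 Y).
Proof.
by rewrite /phi_sasaki !vpart_vlift /= (scalar0 (riemannian_linear gP _ zP)) add0r.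
Qed.

Lemma hlift11H X :
  hlift11 nabla F i z (hlift nabla i z X) = hlift nabla i z (F i z.1 X).
Proof.
rewrite /hlift11 vpart_hlift (linear0 (tensor11_linear FP zP)).
by rewrite /hlift /vlift; congr pair; rewrite /= addr0.
Qed.

Lemma hlift11V X : hlift11 nabla F i z (vlift X) = vlift (F i z.1 X).
Proof.
rewrite /hlift11 vpart_vlift /hlift /vlift /= (linear0 (tensor11_linear FP zP)).
rewrite (linear0 (connection_linearl nablaP z.2 zP)).
by congr pair; rewrite /= ?oppr0 add0r.
Qed.

End LiftTheory.

Record para_kahler_norden (R : realType) (m : nat)
    (M : atlas 'rV[R]_(2 * m)%N)
    (phi : field11 M) (g : field02 M) (nabla : symbols M) : Prop := {
  pkn_manifold : manifold M;
  pkn_riemannian : riemannian g;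
  pkn_levi_civita : levi_civita g nabla;
  pkn_tensor11 : tensor11 phi;
  pkn_involutive : forall i x v, image_of i x -> phi i x (phi i x v) = v;
  pkn_neq_id : ~ (forall i x v, image_of i x -> phi i x v = v);
  pkn_neq_opp : ~ (forall i x v, image_of i x -> phi i x v = - v);
  pkn_rank : forall i x, image_of i x ->
    \rank (eigenspace (lin1_mx (phi i x)) 1) =
    \rank (eigenspace (lin1_mx (phi i x)) (-1));
  pkn_pure : forall i x u v, image_of i x ->
    g i x (phi i x u) v = g i x u (phi i x v);
  pkn_parallel : parallel11 nabla phi }.

(* Main.v *)
Require Import Defs.
From HB Require Import structures.
From mathcomp Require Import all_boot all_order all_algebra.
From mathcomp Require Import all_classical all_reals all_analysis.
From mathcomp Require Import ring lra.
Import Order.TTheory GRing.Theory Num.Theory numFieldNormedType.Exports.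
Local Open Scope classical_set_scope.
Local Open Scope ring_scope.
Set Implicit Arguments.
Unset Strict Implicit.
Unset Printing Implicit Defensive.

(* Write V = K(a) for the vertical part of a tangent vector a = (p, q) of TM at
   (x, v), and h = g(., phi .) for the twin form, so that the phi-Sasaki metric
   is g on horizontal parts plus h on vertical parts.  As h is symmetric and
   parallel, Koszul's formula in an induced chart gives, for the Christoffel
   vector N = N(a, a) of the phi-Sasaki metric and all b = (r, s),
     g(N_1, r) + h(K N, K b) = g(Gamma(p, p), r)
       + h(D_p Gamma(p, v) + Gamma(p, q) + Gamma(p, K a), K b)
       + h(K a, R(p, r) v).
   Since g and h are both parallel, R is skew for both; with the pair symmetry
   of R the last term is - g(R(K a, phi v) p, r).  By nondegeneracy this
   determines N, hence the horizontal and vertical parts of the acceleration of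
   a curve of TM: gamma'' - R(xi', phi xi) gamma' and xi''.  Planarity is then
   read off on the two parts. *)

(** * Maps whose linearity is a hypothesis, as for tensor components over the image of a chart *)

Section LinearPredicate.
Variables (R : pzRingType) (U W : lmodType R) (f : U -> W).
Hypothesis lf : linear f.

Lemma is_linear0 : f 0 = 0.
Proof. by have := lf (-1) 0 0; rewrite scaler0 addr0 scaleN1r addNr. Qed.

Lemma is_linearD u v : f (u + v) = f u + f v.
Proof. by have := lf 1 u v; rewrite !scale1r. Qed.

Lemma is_linearZ a u : f (a *: u) = a *: f u.
Proof. by have := lf a u 0; rewrite !addr0 is_linear0 addr0. Qed.

Lemma is_linearN u : f (- u) = - f u.
Proof. by rewrite -scaleN1r is_linearZ scaleN1r. Qed.

Lemma is_linearB u v : f (u - v) = f u - f v.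
Proof. by rewrite is_linearD is_linearN. Qed.

End LinearPredicate.

(** * Differential calculus *)

(** The differential of [f] also expands [g] to first order at [x], and a first-order expansion with
    continuous linear part is unique. *)
Lemma near_eq_differentiable (R : realType) (V W : normedModType R)
    (f g : V -> W) (x : V) :
  {near x, f =1 g} -> differentiable f x -> differentiable g x.
Proof.
move=> fg df; have [dfc /eqaddoP fE] := (diff_locallyP x f).1 df.
have gE : g \o shift x = cst (g x) + 'd f x +o_ 0 id.
  apply/eqaddoP => e e0; near=> h.
  have <- : f x = g x by exact: nbhs_singleton fg.
  rewrite !fctE /=; have <- : f (h + x) = g (h + x).
    near: h; have := fg; rewrite (near_shift 0 x).
    by apply: filterS => y /=; rewrite subr0.
  by near: h; have := fE e e0; rewrite !fctE.
by apply/diff_locallyP; rewrite (diff_unique dfc gE).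
Unshelve. all: by end_near. Qed.

(** Scaling is a continuous bilinear map, composed here with [y |-> (k y, f y)]. *)
Lemma is_diff_scale (R : realType) (V W : normedModType R)
    (k : V -> R) (f : V -> W) (x : V) :
  differentiable k x -> differentiable f x ->
  is_diff x (fun y => k y *: f y) (fun v => 'd k x v *: f x + k x *: 'd f x v).
Proof.
move=> dk df.
have sbil : bilinear_for
    (GRing.Scale.Law.clone _ _ *:%R _) (GRing.Scale.Law.clone _ _ *:%R _)
    (@GRing.scale R W).
  split=> [u'|u] a y z /=; first by rewrite scalerDl scalerA.
  by rewrite scalerDr !scalerA mulrC.
pose sM := bilinear_isBilinear.Build R R W W _ _ (@GRing.scale R W) sbil.
pose sB : {bilinear R -> W -> W} := HB.pack (@GRing.scale R W) sM.
have cs : continuous (fun p => sB p.1 p.2) by move=> p; exact: scale_continuous.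
have dp := differentiable_pair dk df.
have db : differentiable (fun p => sB p.1 p.2) (k x, f x).
  exact: (differentiable_bilin _ cs).
apply: DiffDef; first exact: (differentiable_comp dp db).
rewrite -[LHS]/(_ ('d ((fun p => sB p.1 p.2) \o (fun y => (k y, f y))) x)).
rewrite (diff_comp dp db) (diff_bilin _ cs) diff_pair//.
by apply/funext => v /=; rewrite addrC.
Qed.

Lemma differentiable_scale (R : realType) (V W : normedModType R)
    (k : V -> R) (f : V -> W) (x : V) :
  differentiable k x -> differentiable f x ->
  differentiable (fun y => k y *: f y) x.
Proof. by move=> dk df; have [] := is_diff_scale dk df. Qed.

Lemma derive_scale (R : realType) (V W : normedModType R)
    (k : V -> R) (f : V -> W) (x v : V) :
  differentiable k x -> differentiable f x ->
  'D_v (fun y => k y *: f y) x = 'D_v k x *: f x + k x *: 'D_v f x.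
Proof.
move=> dk df; have [ds sE] := is_diff_scale dk df.
by rewrite !deriveE// sE.
Qed.

(** * Product rule for a family of linear maps applied to a varying vector *)

Section LinearFamily.
Variables (R : realType) (n : nat) (T W : normedModType R).
Variables (P : T -> 'rV[R]_n -> W) (A : T -> 'rV[R]_n) (z : T).
Hypothesis Plin : \forall y \near z, linear (P y).
Hypothesis Pdiff : forall v, differentiable (P ^~ v) z.
Hypothesis Adiff : differentiable A z.

Let linear_expand (f : 'rV[R]_n -> W) (v : 'rV[R]_n) : linear f ->
  f v = \sum_(j < n) v ord0 j *: f (delta_mx ord0 j).
Proof.
move=> lf; pose fM := GRing.isLinear.Build _ _ _ _ f lf.
pose fL : {linear 'rV[R]_n -> W} := HB.pack f fM.
rewrite -[f]/(fL : _ -> _) {1}(row_sum_delta v) linear_sum.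
by apply: eq_bigr => j _; rewrite linearZ.
Qed.

(** In the standard basis the dependence on [A y] becomes scalar, so the rule for scaling applies to
    each term of a finite sum. *)
Let expansion := \sum_(j < n) fun y => A y ord0 j *: P y (delta_mx ord0 j).

Let near_expansion : {near z, expansion =1 (fun y => P y (A y))}.
Proof.
by near do rewrite /expansion fct_sumE [RHS]linear_expand//.
Unshelve. all: by end_near. Qed.

Let diff_coord j : differentiable (fun y => A y ord0 j) z.
Proof.
exact: (differentiable_comp Adiff (differentiable_coord (A z) ord0 j)).
Qed.

Lemma differentiable_linear_family : differentiable (fun y => P y (A y)) z.
Proof.
apply: near_eq_differentiable near_expansion _.
by apply: differentiable_sum => j; apply: differentiable_scale.
Qed.

(** Both sides are expanded in the basis: one group of terms differentiates [P] with [A z] frozen,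
    the other differentiates the coordinates of [A]. *)
Lemma derive_linear_family w :
  'D_w (fun y => P y (A y)) z = 'D_w (P ^~ (A z)) z + P z ('D_w A z).
Proof.
have Plinz : linear (P z) by exact: nbhs_singleton Plin.
rewrite -(near_eq_derive _ near_expansion) derive_sum; last first.
  by move=> j; apply/diff_derivable/differentiable_scale.
under eq_bigr do rewrite derive_scale// addrC.
rewrite big_split/=; congr (_ + _); last first.
  rewrite [RHS]linear_expand//; apply: eq_bigr => j _.
  by rewrite derive_mx ?mxE//; apply: diff_derivable.
have -> : 'D_w (P ^~ (A z)) z =
    'D_w (\sum_(j < n) fun y => A z ord0 j *: P y (delta_mx ord0 j)) z.
  apply: near_eq_derive.
  by near do rewrite fct_sumE [LHS]linear_expand//.
rewrite derive_sum; last by move=> j; apply/diff_derivable/differentiableZ.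
by apply: eq_bigr => j _; rewrite deriveZ//; apply: diff_derivable.
Unshelve. all: by end_near. Qed.

End LinearFamily.

Lemma derive_comp (R : realType) (U V W : normedModType R)
    (f : U -> V) (h : V -> W) (x v : U) :
  differentiable f x -> differentiable h (f x) ->
  'D_v (h \o f) x = 'D_('D_v f x) h (f x).
Proof.
move=> df dh; rewrite !deriveE//; last exact: differentiable_comp.
by rewrite diff_comp.
Qed.

Section Fst.
Variables (R : realType) (V W : normedModType R).

Lemma differentiable_fst (z : V * W) : differentiable fst z.
Proof.
have lf : linear (fst : V * W -> V) by [].
pose fM := GRing.isLinear.Build _ _ _ _ _ lf.
pose fL : {linear (V * W)%type -> V} := HB.pack (fst : V * W -> V) fM.
by apply: (linear_differentiable (f := fL)) => p; exact: cvg_fst.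
Qed.

Lemma differentiable_snd (z : V * W) : differentiable snd z.
Proof.
have lf : linear (snd : V * W -> W) by [].
pose fM := GRing.isLinear.Build _ _ _ _ _ lf.
pose fL : {linear (V * W)%type -> W} := HB.pack (snd : V * W -> W) fM.
by apply: (linear_differentiable (f := fL)) => p; exact: cvg_snd.
Qed.

(** The two difference quotients compute to the same expression. *)
Lemma derive_fst_comp (X : normedModType R) (f : V -> X) (z w : V * W) :
  'D_w (fun y => f y.1) z = 'D_(w.1) f z.1.
Proof. by []. Qed.

Lemma derive_snd_comp (X : normedModType R) (f : W -> X) (z w : V * W) :
  'D_w (fun y => f y.2) z = 'D_(w.2) f z.2.
Proof. by []. Qed.

Lemma differentiable_fst_comp (X : normedModType R) (f : V -> X) (z : V * W) :
  differentiable f z.1 -> differentiable (fun y : V * W => f y.1) z.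
Proof. by move=> df; exact: (differentiable_comp (differentiable_fst z) df). Qed.

End Fst.

Section PairCurve.
Variables (R : realType) (V W : normedModType R) (f : R -> V * W) (t : R).
Hypothesis df : differentiable f t.

Lemma differentiable_fst_curve : differentiable (fun s => (f s).1) t.
Proof. exact: (differentiable_comp df (differentiable_fst _)). Qed.

Lemma differentiable_snd_curve : differentiable (fun s => (f s).2) t.
Proof. exact: (differentiable_comp df (differentiable_snd _)). Qed.

Lemma derive1_pair :
  derive1 f t = (derive1 (fun s => (f s).1) t, derive1 (fun s => (f s).2) t).
Proof.
rewrite !derive1E; rewrite (derive_comp (1 : R) df (differentiable_fst _)).
rewrite (derive_comp (1 : R) df (differentiable_snd _)).
rewrite (derive_fst_comp (fun y => y)) (derive_snd_comp (fun y => y)) !derive_id.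
exact: surjective_pairing.
Qed.

End PairCurve.

(** The rule for linear families is used twice, first for [w], then for [u] with [w t] frozen; the
    chain rule treats the base point. *)
Lemma derive1_along (R : realType) (n : nat) (V W : normedModType R)
    (P : V -> 'rV[R]_n -> 'rV[R]_n -> W) (c : R -> V) (u w : R -> 'rV[R]_n) (t : R) :
  (\forall y \near c t, forall a, linear (P y a)) ->
  (\forall y \near c t, forall b, linear (P y ^~ b)) ->
  (forall a b, differentiable (fun y => P y a b) (c t)) ->
  differentiable c t -> differentiable u t -> differentiable w t ->
  derivable (fun s => P (c s) (u s) (w s)) t 1 /\
  derive1 (fun s => P (c s) (u s) (w s)) t =
  'D_(derive1 c t) (fun y => P y (u t) (w t)) (c t)
  + P (c t) (derive1 u t) (w t) + P (c t) (u t) (derive1 w t).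
Proof.
move=> Plr Pll dP dc du dw.
have near_c (Q : set V) : (\forall y \near c t, Q y) -> \forall s \near t, Q (c s).
  by move=> nQ; exact: (differentiable_continuous dc).
have dPc a b : differentiable (fun s => P (c s) a b) t.
  exact: (differentiable_comp dc (dP a b)).
have dPl b : differentiable (fun s => P (c s) (u s) b) t.
  apply: (@differentiable_linear_family _ _ _ _ (fun s a => P (c s) a b)) => //.
  by apply: (near_c (fun y => linear (P y ^~ b))); apply: filterS Pll => y; apply.
have nr : \forall s \near t, linear (P (c s) (u s)).
  have := near_c _ Plr; apply: filterS => s; exact.
split.
  apply: diff_derivable.
  exact: (@differentiable_linear_family _ _ _ _ (fun s a => P (c s) (u s) a)).
rewrite !derive1E.
rewrite (@derive_linear_family _ _ _ _ (fun s a => P (c s) (u s) a))//.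
rewrite (@derive_linear_family _ _ _ _ (fun s a => P (c s) a (w t)))//.
  by rewrite -(derive_comp (1 : R) dc (dP _ _)).
by apply: (near_c (fun y => linear (P y ^~ (w t)))); apply: filterS Pll => y; apply.
Qed.

Lemma is_derive_line (R : realType) (V W : normedModType R) (f : V -> W)
    (y u : V) (s : R) : derivable f (s *: u + y) u ->
  is_derive s 1 (fun r => f (r *: u + y)) ('D_u f (s *: u + y)).
Proof.
move=> df; suff quotE : (fun h : R => h^-1 *:
      (((fun r => f (r *: u + y)) \o shift s) (h *: 1) - f (s *: u + y))) =
    (fun h => h^-1 *: ((f \o shift (s *: u + y)) (h *: u) - f (s *: u + y))).
  by apply: DeriveDef; rewrite /derivable /derive quotE.
apply/funext => h /=; congr (_ *: (f _ - _)).
by rewrite [h *: 1]mulr1 scalerDl addrA.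
Qed.

(** * Symmetry of second derivatives *)

Section Young.
Variables (R : realType) (V : normedModType R) (f : V -> R) (x : V).

Let second_difference u w t : R :=
  f (t *: u + (t *: w + x)) - f (t *: w + x) - (f (t *: u + x) - f x).

Let second_differenceC u w t : second_difference u w t = second_difference w u t.
Proof. by rewrite /second_difference addrCA; lra. Qed.

(** The mean value theorem in the direction [u] leaves an increment of ['D_u f]; expanding it to
    first order at [x], the contributions of [u] cancel and that of [w] survives. *)
Let second_difference_approx u w : (\forall y \near x, derivable f y u) ->
  differentiable ('D_u f) x -> forall e : R, 0 < e ->
  \forall t \near 0^'+,
    `|second_difference u w t - t * t * 'D_w ('D_u f) x| <= e * (t * t).
Proof.
move=> fu dfu e e0; rewrite (deriveE _ dfu).
(* The two remainders are controlled by t(|u| + |w|) and t|u|; [C] bounds their sum divided by t,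
   and the added 1 keeps it positive. *)
pose C := `|u| + `|u| + `|w| + 1.
have C0 : 0 < C by rewrite /C; have := normr_ge0 u; have := normr_ge0 w; lra.
have eC : 0 < e / C by rewrite divr_gt0.
have [_ /eqaddoP dE] := (diff_locallyP x _).1 dfu.
have /nbhs_normP[d /= d0 dB] : \forall h \near (0 : V), derivable f (h + x) u /\
    `|'D_u f (h + x) - 'D_u f x - 'd ('D_u f) x h| <= e / C * `|h|.
  have fu0 : \forall h \near (0 : V), derivable f (h + x) u.
    have := fu; rewrite (near_shift 0 x).
    by apply: filterS => y /=; rewrite subr0.
  have dE0 := dE _ eC.
  near=> h; split; first by near: h.
  have : `|('D_u f \o shift x - (cst ('D_u f x) + 'd ('D_u f) x)) h| <=
    e / C * `|h| by near: h.
  by rewrite !fctE/= opprD addrA.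
have dB' h : `|h| < d -> derivable f (h + x) u /\
    `|'D_u f (h + x) - 'D_u f x - 'd ('D_u f) x h| <= e / C * `|h|.
  by move=> hd; apply: dB; rewrite /= sub0r normrN.
near=> t.
have t0 : 0 < t by near: t; exact: nbhs_right_gt.
have td : t * C < d.
  by rewrite -ltr_pdivlMr//; near: t; apply: nbhs_right_lt; rewrite divr_gt0.
have small s : 0 <= s -> s <= t ->
    `|s *: u + t *: w| < d /\ `|s *: u| < d /\
    `|s *: u + t *: w| <= t * (`|u| + `|w|) /\ `|s *: u| <= t * `|u|.
  move=> s0 st.
  have su : `|s *: u| <= t * `|u| by rewrite normrZ ger0_norm// ler_wpM2r.
  have tw : `|t *: w| = t * `|w| by rewrite normrZ gtr0_norm.
  have := ler_normD (s *: u) (t *: w); rewrite tw => suw.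
  have := mulr_ge0 (ltW t0) (normr_ge0 u); have := mulr_ge0 (ltW t0) (normr_ge0 w).
  move: td; rewrite /C => td *; split; [|split; [|split]] => //; nra.
(* The second difference is [psi t - psi 0]. *)
pose psi s := f (s *: u + (t *: w + x)) - f (s *: u + x).
pose dpsi s := 'D_u f (s *: u + (t *: w + x)) - 'D_u f (s *: u + x).
have dpsiE s : 0 <= s -> s <= t -> is_derive s 1 psi (dpsi s).
  move=> s0 st; have [/dB'[h1 _] [/dB'[h2 _] _]] := small s s0 st.
  by apply: is_deriveB; apply: is_derive_line; rewrite ?addrA.
have [||s] := @MVT R psi dpsi 0 t t0.
- by move=> s /[!in_itv]/= /andP[/ltW s0 /ltW st]; exact: dpsiE.
- apply: derivable_within_continuous => s /[!in_itv]/= /andP[s0 st].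
  by have [] := dpsiE s s0 st.
rewrite in_itv/= => /andP[/ltW s0 /ltW st].
rewrite /psi /dpsi !scale0r !add0r subr0 => psiE.
have -> : second_difference u w t = dpsi s * t.
  by rewrite -[RHS]psiE /second_difference; lra.
have [/dB'[_ h1] [/dB'[_ h2] [n1 n2]]] := small s s0 st.
set L := 'd ('D_u f) x w; set K := 'd ('D_u f) x u.
have E1 : 'd ('D_u f) x (s *: u + t *: w) = s * K + t * L.
  by rewrite linearD !linearZ.
have E2 : 'd ('D_u f) x (s *: u) = s * K by rewrite linearZ.
move: h1 h2; rewrite E1 E2 /dpsi addrA.
set a := 'D_u f _; set b := 'D_u f (s *: u + x); set c := 'D_u f x => h1 h2.
have h3 : `|a - b - t * L| <= e * t.
  have -> : a - b - t * L = (a - c - (s * K + t * L)) - (b - c - s * K) by lra.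
  apply: (le_trans (ler_normB _ _)); apply: (le_trans (lerD h1 h2)).
  rewrite -mulrDr -mulrA ler_wpM2l ?(ltW e0)//.
  rewrite mulrC ler_pdivrMr//; apply: (le_trans (lerD n1 n2)); rewrite /C; nra.
have -> : (a - b) * t - t * t * L = (a - b - t * L) * t by lra.
by rewrite normrM (gtr0_norm t0) mulrA ler_wpM2r// ltW.
Unshelve. all: by end_near. Qed.

(** The second difference is symmetric in [u] and [w], so after division by t^2 it approximates both
    mixed derivatives, each within [e / 2]. *)
Lemma derive_swap u w :
  (\forall y \near x, derivable f y u) -> (\forall y \near x, derivable f y w) ->
  differentiable ('D_u f) x -> differentiable ('D_w f) x ->
  'D_w ('D_u f) x = 'D_u ('D_w f) x.
Proof.
move=> fu fw dfu dfw; apply/eqP; rewrite -subr_eq0 -normr_le0.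
apply/ler_addgt0Pr => e e0; rewrite add0r.
have e2 : 0 < e / 2 by lra.
have hu := second_difference_approx w fu dfu e2.
have hw := second_difference_approx u fw dfw e2.
have [t [[h1 h2] t0]] := filter_ex (filterI (filterI hu hw) (nbhs_right_gt 0)).
move: h1 h2; rewrite second_differenceC.
move: (second_difference _ _ _) ('D_w _ x) ('D_u _ x) => D L K h1 h2.
rewrite -(ler_pM2l (mulr_gt0 t0 t0)) -[X in X * `|_|]gtr0_norm ?mulr_gt0//.
rewrite -normrM.
have -> : t * t * (L - K) = (D - t * t * K) - (D - t * t * L) by ring.
by apply: (le_trans (ler_normB _ _)); lra.
Qed.

End Young.

(** * Curvature *)

(** Fields with constant components have zero bracket, and the covariant derivative of one along
    another is given by the symbols alone. *)
Lemma curvatureE (R : realType) (E : normedModType R) (M : atlas E)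
    (nabla : symbols M) (i : chart M) (x u v w : E) :
  connection nabla -> image_of i x ->
  curvature nabla i x u v w =
  'D_u (fun y => nabla i y v w) x - 'D_v (fun y => nabla i y u w) x
  + nabla i x u (nabla i x v w) - nabla i x v (nabla i x u w).
Proof.
move=> nablaP xU; have cov_cst a b : cov nabla i (fun=> a) (fun=> b) =
    (fun y => nabla i y a b).
  by apply/funext => y; rewrite /cov derive_cst add0r.
rewrite /curvature /curvature_field !cov_cst /cov /bracket /=.
rewrite !derive_cst subrr (is_linear0 (connection_linearl nablaP w xU)) addr0 subr0.
by rewrite opprD addrACA addrA.
Qed.

(** * Skewness of the curvature for a parallel bilinear form *)

Section ParallelForm.
Variables (R : realType) (n : nat) (M : atlas 'rV[R]_n) (nabla : symbols M).
Variables (i : chart M) (h : 'rV[R]_n -> 'rV[R]_n -> 'rV[R]_n -> R).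
Hypotheses (nablaP : connection nabla) (oU : open (image_of i)).
Hypothesis hlinl : forall x v, image_of i x -> linear (h x ^~ v).
Hypothesis hlinr : forall x u, image_of i x -> linear (h x u).
Hypothesis hdiff : forall x u v,
  image_of i x -> differentiable (fun y => h y u v) x.
Hypothesis hparallel : forall x w u v, image_of i x ->
  'D_w (fun y => h y u v) x = h x (nabla i x w u) v + h x u (nabla i x w v).

Let nearU x : image_of i x -> \forall y \near x, image_of i y.
Proof. by move=> xU; apply: open_nbhs_nbhs. Qed.

Let nabla_diff x u v :
  image_of i x -> differentiable (fun y => nabla i y u v) x.
Proof. by move=> xU; have [+ _] := connection_smooth nablaP i u v 1; apply. Qed.

Let diffl x c k l : image_of i x ->
  differentiable (fun y => h y (nabla i y c k) l) x.
Proof.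
move=> xU; apply: (@differentiable_linear_family _ _ _ _ (fun y a => h y a l)).
- by near do apply: hlinl; exact: nearU.
- by move=> a; exact: hdiff.
- exact: nabla_diff.
Unshelve. all: by end_near. Qed.

Let diffr x c k l : image_of i x ->
  differentiable (fun y => h y k (nabla i y c l)) x.
Proof.
move=> xU; apply: (@differentiable_linear_family _ _ _ _ (fun y a => h y k a)).
- by near do apply: hlinr; exact: nearU.
- by move=> a; exact: hdiff.
- exact: nabla_diff.
Unshelve. all: by end_near. Qed.

Let derivel x w c k l : image_of i x ->
  'D_w (fun y => h y (nabla i y c k) l) x =
  h x (nabla i x w (nabla i x c k)) l + h x (nabla i x c k) (nabla i x w l)
  + h x ('D_w (fun y => nabla i y c k) x) l.
Proof.
move=> xU; rewrite (@derive_linear_family _ _ _ _ (fun y a => h y a l)).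
- by rewrite hparallel.
- by near do apply: hlinl; exact: nearU.
- by move=> a; exact: hdiff.
- exact: nabla_diff.
Unshelve. all: by end_near. Qed.

Let deriver x w c k l : image_of i x ->
  'D_w (fun y => h y k (nabla i y c l)) x =
  h x (nabla i x w k) (nabla i x c l) + h x k (nabla i x w (nabla i x c l))
  + h x k ('D_w (fun y => nabla i y c l) x).
Proof.
move=> xU; rewrite (@derive_linear_family _ _ _ _ (fun y a => h y k a)).
- by rewrite hparallel.
- by near do apply: hlinr; exact: nearU.
- by move=> a; exact: hdiff.
- exact: nabla_diff.
Unshelve. all: by end_near. Qed.

(** Parallelism turns the first derivative of [h] into values of [h] on symbols, to which the
    product rule and parallelism apply again. *)
Let hess x u v k l : image_of i x ->
  'D_u ('D_v (fun y => h y k l)) x =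
  h x (nabla i x u (nabla i x v k)) l + h x (nabla i x v k) (nabla i x u l)
  + h x ('D_u (fun y => nabla i y v k) x) l
  + (h x (nabla i x u k) (nabla i x v l) + h x k (nabla i x u (nabla i x v l))
  + h x k ('D_u (fun y => nabla i y v l) x)).
Proof.
move=> xU; rewrite -derivel// -deriver// -deriveD.
- by apply: near_eq_derive; near do (rewrite hparallel//); exact: nearU.
- exact/diff_derivable/diffl.
- exact/diff_derivable/diffr.
Unshelve. all: by end_near. Qed.

Let diff_derive x v k l :
  image_of i x -> differentiable ('D_v (fun y => h y k l)) x.
Proof.
move=> xU.
have := differentiableD (@diffl x v k l xU) (@diffr x v k l xU).
apply: near_eq_differentiable; near do (rewrite hparallel//); exact: nearU.
Unshelve. all: by end_near. Qed.

(** Second derivatives of [y |-> h y k l] commute. In their difference the products of two symbols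
    cancel, and what remains is the curvature acting on each argument. *)
Lemma curvature_skew x u v k l : image_of i x ->
  h x (curvature nabla i x u v k) l = - h x k (curvature nabla i x u v l).
Proof.
move=> xU; have hd a b c : \forall y \near x, derivable (fun y => h y a b) y c.
  by near=> y; apply/diff_derivable/hdiff; near: y; exact: nearU.
have := derive_swap (hd k l u) (hd k l v) (diff_derive u k l xU)
  (diff_derive v k l xU).
rewrite !hess// !curvatureE//.
have hlD a b : h x (a + b) l = h x a l + h x b l := is_linearD (hlinl l xU) a b.
have hlB a b : h x (a - b) l = h x a l - h x b l := is_linearB (hlinl l xU) a b.
have hrD a b : h x k (a + b) = h x k a + h x k b := is_linearD (hlinr k xU) a b.
have hrB a b : h x k (a - b) = h x k a - h x k b := is_linearB (hlinr k xU) a b.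
rewrite !(hlB, hlD) !(hrB, hrD).
by lra.
Unshelve. all: by end_near. Qed.

End ParallelForm.

Lemma open_image_of (R : realType) (E : normedModType R) (M : atlas E)
    (i : chart M) : manifold M -> open (image_of i).
Proof.
by move=> MP; have := open_overlap MP i i; rewrite /overlap setIid.
Qed.

(* The four Bianchi identities obtained by cyclically permuting the arguments
   are combined with signs +, +, -, -. *)
Lemma pair_symmetry (R : realDomainType) (V : Type) (r : V -> V -> V -> V -> R) :
  (forall a b c d, r a b c d = - r b a c d) ->
  (forall a b c d, r a b c d = - r a b d c) ->
  (forall a b c d, r a b c d + r b c a d + r c a b d = 0) ->
  forall u v w z, r u v w z = r w z u v.
Proof.
move=> s12 s34 b3 u v w z.
have := (b3 u v w z, b3 v w z u, b3 w z u v, b3 z u v w).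
move: (s34 v w u z) (s12 u w z v) (s34 w u z v) (s12 v z u w) (s34 z v u w)
  (s34 z u w v) (s34 w z v u) (s34 u v z w) => ? ? ? ? ? ? ? ? [[[? ?] ?] ?].
lra.
Qed.

(** * Symmetries of the Levi-Civita curvature *)

Section LeviCivitaCurvature.
Variables (R : realType) (n : nat) (M : atlas 'rV[R]_n).
Variables (g : field02 M) (nabla : symbols M) (i : chart M).
Hypotheses (MP : manifold M) (gP : riemannian g) (nablaP : levi_civita g nabla).

Lemma riemannian_linearl x v : image_of i x -> linear (g i x ^~ v).
Proof.
move=> xU a u w; rewrite !(riemannian_sym gP _ v xU).
exact: (riemannian_linear gP).
Qed.

Lemma riemannian_linearr x u : image_of i x -> linear (g i x u).
Proof. by move=> xU a v w; exact: (riemannian_linear gP). Qed.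

Lemma riemannian_differentiable x u v :
  image_of i x -> differentiable (fun y => g i y u v) x.
Proof. by move=> xU; have [+ _] := riemannian_smooth gP i u v 1; apply. Qed.

Lemma connection_differentiable x u v :
  image_of i x -> differentiable (fun y => nabla i y u v) x.
Proof.
move=> xU.
by have [+ _] := connection_smooth (levi_civita_connection nablaP) i u v 1; apply.
Qed.

Let regroup (V : zmodType) (a b c d : V) : a - b + c - d = (a + c) - (b + d).
Proof. by rewrite opprD addrACA addrA. Qed.

Lemma curvature_antisym x u v w : image_of i x ->
  curvature nabla i x u v w = - curvature nabla i x v u w.
Proof.
move=> xU; rewrite !(curvatureE _ _ _ (levi_civita_connection nablaP) xU).
by rewrite !regroup opprB.
Qed.

(** Absence of torsion makes derivatives of symbols and iterated symbols cancel in pairs over the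
    cyclic sum. *)
Lemma curvature_bianchi x u v w : image_of i x ->
  curvature nabla i x u v w + curvature nabla i x v w u
  + curvature nabla i x w u v = 0.
Proof.
move=> xU; rewrite !(curvatureE _ _ _ (levi_civita_connection nablaP) xU).
have dsym a b c : 'D_a (fun y => nabla i y b c) x = 'D_a (fun y => nabla i y c b) x.
  apply: near_eq_derive; near=> y; apply: (levi_civita_torsionfree nablaP).
  by near: y; apply: open_nbhs_nbhs; split=> //; exact: open_image_of.
rewrite (dsym v u w) (dsym w v u) (dsym u w v).
rewrite (levi_civita_torsionfree nablaP v w xU)
  (levi_civita_torsionfree nablaP u w xU)
  (levi_civita_torsionfree nablaP v u xU).
by rewrite !regroup !subrKA subrr.
Unshelve. all: by end_near. Qed.

Lemma curvature_pair_symmetry x u v w z : image_of i x ->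
  g i x (curvature nabla i x u v w) z = g i x (curvature nabla i x w z u) v.
Proof.
move=> xU; have xsk := curvature_skew (levi_civita_connection nablaP)
  (open_image_of i MP) riemannian_linearl riemannian_linearr
  riemannian_differentiable (levi_civita_metric nablaP (i := i)).
apply: (pair_symmetry (r := fun a b c d => g i x (curvature nabla i x a b c) d)).
- move=> a b c d.
  by rewrite curvature_antisym// (is_linearN (riemannian_linearl d xU)).
- by move=> a b c d; rewrite xsk// (riemannian_sym gP _ _ xU).
- move=> a b c d; rewrite -!(is_linearD (riemannian_linearl d xU)).
  by rewrite curvature_bianchi// (is_linear0 (riemannian_linearl d xU)).
Qed.

End LeviCivitaCurvature.

(** * The phi-Sasaki metric *)

Section Sasaki.
Variables (R : realType) (m : nat) (M : atlas 'rV[R]_(2 * m)%N).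
Variables (phi : field11 M) (g : field02 M) (nabla : symbols M) (i : chart M).
Hypothesis MP : para_kahler_norden phi g nabla.

Local Notation V := 'rV[R]_(2 * m)%N.
Let gP := pkn_riemannian MP.
Let lcP := pkn_levi_civita MP.
Let nablaP := levi_civita_connection lcP.
Let phiP := pkn_tensor11 MP.
Let oU : open (image_of i) := open_image_of i (pkn_manifold MP).

Let nearU x : image_of i x -> \forall y \near x, image_of i y.
Proof. by move=> xU; apply: open_nbhs_nbhs; split. Qed.

Definition twin (x k l : V) : R := g i x k (phi i x l).

Lemma twin_sym x k l : image_of i x -> twin x k l = twin x l k.
Proof. by move=> xU; rewrite /twin -(pkn_pure MP)// (riemannian_sym gP). Qed.

Lemma twin_linearr x k : image_of i x -> linear (twin x k).
Proof.
move=> xU a u v; rewrite /twin (tensor11_linear phiP xU).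
exact: (riemannian_linearr gP).
Qed.

Lemma twin_linearl x l : image_of i x -> linear (twin x ^~ l).
Proof. by move=> xU; exact: (riemannian_linearl gP). Qed.

Let phi_differentiable x v :
  image_of i x -> differentiable (fun y => phi i y v) x.
Proof. by move=> xU; have [+ _] := tensor11_smooth phiP i v 1; apply. Qed.

Lemma twin_differentiable x k l :
  image_of i x -> differentiable (fun y => twin y k l) x.
Proof.
move=> xU; apply: (@differentiable_linear_family _ _ _ _ (fun y a => g i y k a)).
- by near do apply: (riemannian_linearr gP); exact: nearU.
- by move=> a; exact: (riemannian_differentiable gP).
- exact: phi_differentiable.
Unshelve. all: by end_near. Qed.

(** Parallelism of [phi] gives the derivative of [phi l] as phi(nabla_w l) - nabla_w(phi l); the
    last term cancels against one coming from metric compatibility. *)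
Lemma twin_parallel x w k l : image_of i x ->
  'D_w (fun y => twin y k l) x =
  twin x (nabla i x w k) l + twin x k (nabla i x w l).
Proof.
move=> xU; rewrite (@derive_linear_family _ _ _ _ (fun y a => g i y k a)).
- have := pkn_parallel MP w l xU; rewrite /cov derive_cst add0r.
  move/(canRL (addrK _)) => ->; rewrite (levi_civita_metric lcP)//.
  by rewrite (is_linearB (riemannian_linearr gP k xU)) /twin; lra.
- by near do apply: (riemannian_linearr gP); exact: nearU.
- by move=> a; exact: (riemannian_differentiable gP).
- exact: phi_differentiable.
Unshelve. all: by end_near. Qed.

(* Both [g] and the twin form [g(., phi .)] are parallel, so that the curvature
   operators are skew for both. *)
Lemma twin_curvature x p r v k : image_of i x ->
  twin x k (curvature nabla i x p r v) =
  - g i x (curvature nabla i x k (phi i x v) p) r.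
Proof.
move=> xU.
have := curvature_skew nablaP oU twin_linearl twin_linearr twin_differentiable
  twin_parallel p r k v xU.
rewrite {1 2}/twin (curvature_pair_symmetry (pkn_manifold MP) gP lcP)//.
by move/eqP; rewrite eq_sym eqr_oppLR => /eqP.
Qed.

Section Metric.
Variable z : V * V.
Hypothesis zU : image_of i z.1.
Let x := z.1.
Let v := z.2.

Lemma phi_sasaki_sym a b :
  phi_sasaki nabla phi g i z a b = phi_sasaki nabla phi g i z b a.
Proof.
by congr (_ + _); [exact: (riemannian_sym gP)|exact: twin_sym].
Qed.

(** Positivity is available for [g] only. The test vectors are the horizontal lift of [a] and the
    vertical lift of phi c, since g(c, phi(phi c)) = g(c, c). *)
Lemma phi_sasaki_nondegenerate a c :
  (forall b, g i x a b.1 + twin x c (vpart nabla i z b) = 0) -> a = 0 /\ c = 0.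
Proof.
move=> ab0; have vp0 b : vpart nabla i z (0, b) = b.
  by rewrite /vpart/= (is_linear0 (connection_linearl nablaP z.2 zU)) addr0.
have gnd u : g i x u u = 0 -> u = 0.
  move=> gu; apply/eqP/negP => /negP/eqP u0.
  by have := riemannian_pos gP zU u0; rewrite gu ltxx.
split; apply: gnd.
  have := ab0 (hlift nabla i z a).
  by rewrite vpart_hlift/= (is_linear0 (twin_linearr c zU)) addr0.
have := ab0 (vlift (phi i x c)); rewrite /vlift vp0/= /twin (pkn_involutive MP)//.
by rewrite (is_linear0 (riemannian_linearr gP a zU)) add0r.
Qed.

Let nearU1 : \forall y \near z, image_of i y.1.
Proof. by apply: cvg_fst; exact: nearU. Qed.

Let differentiable_nabla a c : differentiable (fun y : V * V => nabla i y.1 a c) z.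
Proof.
apply: (differentiable_fst_comp (f := fun y => nabla i y a c)).
exact: (connection_differentiable lcP).
Qed.

Let differentiable_nabla_snd a :
  differentiable (fun y : V * V => nabla i y.1 a y.2) z.
Proof.
apply: (@differentiable_linear_family _ _ _ _ (fun y b => nabla i y.1 a b)).
- by apply: filterS nearU1 => y yU; exact: (connection_linearr nablaP).
- by move=> c; exact: differentiable_nabla.
- exact: differentiable_snd.
Qed.

Lemma differentiable_vpart a : differentiable (fun y => vpart nabla i y a) z.
Proof.
by apply: differentiableD => //; exact: differentiable_cst.
Qed.

Lemma derive_vpart a w : 'D_w (fun y => vpart nabla i y a) z =
  'D_(w.1) (fun y => nabla i y a.1 v) x + nabla i x a.1 w.2.
Proof.
rewrite deriveD; [|exact: derivable_cst|exact: diff_derivable].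
rewrite derive_cst add0r.
rewrite (@derive_linear_family _ _ _ _ (fun y b => nabla i y.1 a.1 b)).
- by rewrite (derive_snd_comp (fun y => y)) derive_id.
- by apply: filterS nearU1 => y yU; exact: (connection_linearr nablaP).
- by move=> c; exact: differentiable_nabla.
- exact: differentiable_snd.
Qed.

Let differentiable_twin k l : differentiable (fun y : V * V => twin y.1 k l) z.
Proof.
apply: (differentiable_fst_comp (f := fun y => twin y k l)).
exact: twin_differentiable.
Qed.

Let differentiable_twin_vpart a l :
  differentiable (fun y => twin y.1 (vpart nabla i y a) l) z.
Proof.
apply: (@differentiable_linear_family _ _ _ _ (fun y k => twin y.1 k l)) => //.
- by apply: filterS nearU1 => y yU; exact: twin_linearl.
- exact: differentiable_vpart.
Qed.

(** There are three sources: [g] and the twin form, both parallel along [w.1], and the two vertical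
    parts, which vary with the point of the bundle. *)
Lemma derive_phi_sasaki w a b (k := vpart nabla i z a) (l := vpart nabla i z b) :
  'D_w (fun y => phi_sasaki nabla phi g i y a b) z =
  g i x (nabla i x w.1 a.1) b.1 + g i x a.1 (nabla i x w.1 b.1)
  + (twin x (nabla i x w.1 k) l + twin x k (nabla i x w.1 l)
  + twin x ('D_(w.1) (fun y => nabla i y a.1 v) x + nabla i x a.1 w.2) l
  + twin x k ('D_(w.1) (fun y => nabla i y b.1 v) x + nabla i x b.1 w.2)).
Proof.
have dg : differentiable (fun y : V * V => g i y.1 a.1 b.1) z.
  apply: (differentiable_fst_comp (f := fun y => g i y a.1 b.1)).
  exact: (riemannian_differentiable gP).
have linr y : image_of i y.1 ->
    linear (fun c => twin y.1 (vpart nabla i y a) c).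
  by move=> yU; exact: twin_linearr.
have near_linr : \forall y \near z, linear (twin y.1 (vpart nabla i y a)).
  by apply: filterS nearU1.
have dt : differentiable
    (fun y => twin y.1 (vpart nabla i y a) (vpart nabla i y b)) z.
  apply: (@differentiable_linear_family _ _ _ _
    (fun y c => twin y.1 (vpart nabla i y a) c)) => //.
  exact: differentiable_vpart.
rewrite (deriveD (diff_derivable dg) (diff_derivable dt)); congr (_ + _).
  by rewrite (derive_fst_comp (fun y => g i y a.1 b.1)) (levi_civita_metric lcP).
rewrite (@derive_linear_family _ _ _ _
  (fun y c => twin y.1 (vpart nabla i y a) c))//; last exact: differentiable_vpart.
rewrite derive_vpart; congr (_ + _).
rewrite (@derive_linear_family _ _ _ _ (fun y c => twin y.1 c l))//.
- by rewrite derive_vpart (derive_fst_comp (fun y => twin y k l)) twin_parallel.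
- by apply: filterS nearU1 => y yU; exact: twin_linearl.
- exact: differentiable_vpart.
Qed.

End Metric.

End Sasaki.

(** * Christoffel symbols of the phi-Sasaki metric *)

Section Koszul.
Variables (R : realType) (m : nat) (M : atlas 'rV[R]_(2 * m)%N).
Variables (phi : field11 M) (g : field02 M) (nabla : symbols M) (i : chart M).
Variable nablaT : symbols (tangent_bundle M).
Hypothesis MP : para_kahler_norden phi g nabla.
Hypothesis lcT : levi_civita (phi_sasaki nabla phi g) nablaT.
Variable z : 'rV[R]_(2 * m)%N * 'rV[R]_(2 * m)%N.
Hypothesis zT : image_of (M := tangent_bundle M) i z.
Let x := z.1.
Let v := z.2.

Lemma image_of_tangent_bundle : image_of i x.
Proof. by rewrite /x; case: zT => -[p w] [/= pi _] <-; exists p. Qed.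
Let xU := image_of_tangent_bundle.

Let gP := pkn_riemannian MP.
Let nablaP := levi_civita_connection (pkn_levi_civita MP).

Local Notation G := (phi_sasaki nabla phi g i z).

(** By metric compatibility the derivative along [a] also produces G(a, N(a, b)), which without
    torsion is half the derivative of G(a, a) along [b]. *)
Lemma koszul a b : 2 * G (nablaT i z a a) b =
  2 * 'D_a (fun y => phi_sasaki nabla phi g i y a b) z
  - 'D_b (fun y => phi_sasaki nabla phi g i y a a) z.
Proof.
rewrite !(levi_civita_metric lcT _ _ _ zT) (levi_civita_torsionfree lcT b a zT).
rewrite (phi_sasaki_sym MP (z := z) xU (nablaT i z a b) a).
by move: (G _ _) (G _ _) => c d; lra.
Qed.

(** Accelerations involve the symbols on the diagonal only. Both differences vanish by
    nondegeneracy, tested on an arbitrary [b] through the Koszul formula. *)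
Lemma sasaki_symbols a (p := a.1) (k := vpart nabla i z a) :
  (nablaT i z a a).1 = nabla i x p p - curvature nabla i x k (phi i x v) p /\
  vpart nabla i z (nablaT i z a a) =
  'D_p (fun y => nabla i y p v) x + nabla i x p a.2 + nabla i x p k.
Proof.
suff [/eqP n1 /eqP n2] : (nablaT i z a a).1
    - (nabla i x p p - curvature nabla i x k (phi i x v) p) = 0 /\
    vpart nabla i z (nablaT i z a a)
    - ('D_p (fun y => nabla i y p v) x + nabla i x p a.2 + nabla i x p k) = 0.
  by split; apply/eqP; rewrite -subr_eq0.
apply: (phi_sasaki_nondegenerate MP xU) => b.
pose r := b.1; pose l := vpart nabla i z b.
have := koszul a b; rewrite !(derive_phi_sasaki MP xU).
rewrite (_ : phi_sasaki _ _ _ _ _ _ _ = g i x (nablaT i z a a).1 r +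
  twin phi g i x (vpart nabla i z (nablaT i z a a)) l)//.
(* Only R(p, r)v is expanded, to match the derivatives of symbols in the Koszul formula; R(k, phi
   v)p stays closed because it appears in the result. *)
have := twin_curvature MP p r v k xU; rewrite (curvatureE _ _ _ nablaP xU).
rewrite -/p -/k -/r -/l -/x -/v.
rewrite (twin_sym MP (nabla i x r k) k xU).
rewrite (twin_sym MP ('D_r (fun y => nabla i y p v) x + nabla i x p b.2) k xU).
rewrite (riemannian_sym gP (nabla i x r p) p xU).
rewrite (levi_civita_torsionfree (pkn_levi_civita MP) r p xU).
have nr c d e : nabla i x e (c + d) = nabla i x e c + nabla i x e d
  := is_linearD (connection_linearr nablaP e xU) c d.
(* Unfolding [l] and [k] under a further symbol supplies the iterated symbols of R(p, r)v. *)
have lE : nabla i x p l = nabla i x p b.2 + nabla i x p (nabla i x r v).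
  by rewrite /l /vpart nr.
have kE : nabla i x r k = nabla i x r a.2 + nabla i x r (nabla i x p v).
  by rewrite /k /vpart nr.
rewrite {}lE {}kE.
have gB c d e : g i x (c - d) e = g i x c e - g i x d e :=
  is_linearB (riemannian_linearl gP e xU) c d.
have tl c d e : twin phi g i x (c + d) e = twin phi g i x c e + twin phi g i x d e
  := is_linearD (twin_linearl MP e xU) c d.
have tlB c d e : twin phi g i x (c - d) e = twin phi g i x c e - twin phi g i x d e
  := is_linearB (twin_linearl MP e xU) c d.
have tr c d e : twin phi g i x e (c + d) = twin phi g i x e c + twin phi g i x e d
  := is_linearD (twin_linearr MP e xU) c d.
have trB c d e : twin phi g i x e (c - d) = twin phi g i x e c - twin phi g i x e d
  := is_linearB (twin_linearr MP e xU) c d.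
(* Once the vectors are abstracted, a linear identity between values of [g] and of the twin form
   remains. *)
move: (curvature _ _ _ _ _ _) (twin phi g i x) gB tl tlB tr trB => Rm tw gB tl tlB tr trB.
move: (vpart nabla i z (nablaT i z a a)) (nablaT i z a a).1 => n2 n1.
move: (nabla i x r a.2) (nabla i x r (nabla i x p v)) (nabla i x p b.2)
  (nabla i x p (nabla i x r v)) (nabla i x p a.2) (nabla i x p p)
  (nabla i x p k) (nabla i x p r)
  ('D_p (fun y => nabla i y p v) x) ('D_p (fun y => nabla i y r v) x)
  ('D_r (fun y => nabla i y p v) x) => c1 c2 c3 c4 c5 c6 c7 c8 c9 c10 c11.
move: (g i x) gB (k) (l) (r) (p) => gx gB k' l' r' p'.
rewrite !(trB, tr) !(tlB, tl) !gB => h1 h2.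
lra.
Qed.

End Koszul.

(** * Curves in the tangent bundle *)

Section TangentBundle.
Variables (R : realType) (E : normedModType R) (M : atlas E).
Hypothesis MP : manifold M.

Lemma trans_coords (i j : chart M) p : dom i p -> trans i j (coords i p) = coords j p.
Proof. by move=> ip; rewrite /trans /= (coordsK MP). Qed.

Lemma near_overlap (i j : chart M) p : dom i p -> dom j p ->
  \forall y \near coords i p, overlap i j y.
Proof.
move=> ip jp; apply: open_nbhs_nbhs; split; first exact: open_overlap MP i j.
by exists p.
Qed.

Lemma trans_differentiable (i j : chart M) p : dom i p -> dom j p ->
  differentiable (trans i j) (coords i p).
Proof.
by move=> ip jp; have [+ _] := smooth_trans MP i j 1; apply; exists p.
Qed.

(** Near the point [trans i k] factors through the chart [j], and the chain rule applies. *)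
Lemma derive_trans (i j k : chart M) p u : dom i p -> dom j p -> dom k p ->
  'D_u (trans i k) (coords i p) =
  'D_('D_u (trans i j) (coords i p)) (trans j k) (coords j p).
Proof.
move=> ip jp kp; rewrite -(trans_coords j ip) -derive_comp; last 2 first.
- exact: trans_differentiable.
- by rewrite trans_coords//; exact: trans_differentiable.
apply: near_eq_derive; near=> y.
have [q [iq jq] yE] : overlap i j y by near: y; exact: near_overlap.
by rewrite -yE /= !trans_coords.
Unshelve. all: by end_near. Qed.

Lemma derive_trans_refl (i : chart M) p u : dom i p ->
  'D_u (trans i i) (coords i p) = u.
Proof.
move=> ip; rewrite -[RHS](derive_id (coords i p) u); apply: near_eq_derive.
near=> y; have [q [iq _] yE] : overlap i i y by near: y; exact: near_overlap.
by rewrite -yE /= trans_coords.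
Unshelve. all: by end_near. Qed.

(** The components in the other charts are forced by the transition maps, and [derive_trans] makes
    them compatible. *)
Lemma tangent_extension (i : chart M) p u : dom i p ->
  exists2 w, tangent p w & w i = u.
Proof.
move=> ip.
exists (fun j => if `[< dom j p >] then 'D_u (trans i j) (coords i p) else 0).
  split=> [j jp|j k jp kp]; first by case: asboolP.
  by rewrite !asboolT//; exact: derive_trans.
by rewrite asboolT// derive_trans_refl.
Qed.

(** By [tangent_extension] the fibres are full, so in the chart [j] this domain is the preimage of
    an overlap under the first projection. *)
Lemma mopen_tangent_chart (i : chart M) : mopen (dom (i : chart (tangent_bundle M))).
Proof.
split=> [q iq|j]; first by exists i.
suff -> : @coords _ _ (tangent_bundle M) j @`
    (@dom _ _ (tangent_bundle M) i `&` @dom _ _ (tangent_bundle M) j) =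
    fst @^-1` overlap (M := M) j i.
  by apply: open_comp; [move=> y _; exact: cvg_fst|exact: (open_overlap MP)].
apply/seteqP; split=> [_ [q [[iq _] [jq _]] <-]|y [p [jp ip] yE]].
  by exists q.1.
have [w wt wj] := tangent_extension y.2 jp.
by exists (p, w) => //=; rewrite yE wj -surjective_pairing.
Qed.

End TangentBundle.

Lemma vpart_linear (R : realType) (E : normedModType R) (M : atlas E)
    (nabla : symbols M) (i : chart M) (z : E * E) :
  connection nabla -> image_of i z.1 -> linear (vpart nabla i z).
Proof.
move=> nablaP zU a b d; rewrite /vpart/= (connection_linearl nablaP _ zU).
by rewrite scalerDr addrACA.
Qed.

(** * Velocity and acceleration of a curve in the tangent bundle *)

Section Curve.
Variables (R : realType) (m : nat) (M : atlas 'rV[R]_(2 * m)%N).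
Variables (phi : field11 M) (g : field02 M) (nabla : symbols M) (i : chart M).
Variables (nablaT : symbols (tangent_bundle M)).
Variables (J : set R) (Gamma : R -> mpoint (tangent_bundle M)).
Hypothesis MP : para_kahler_norden phi g nabla.
Hypothesis lcT : levi_civita (phi_sasaki nabla phi g) nablaT.
Hypothesis GammaP : smooth_curve J Gamma.

Let gamma := base_curve Gamma.
Let xi := fibre_field Gamma.
Let gamma' := velocity gamma.
Let xi' := cov_along nabla gamma xi.
Let nablaP := levi_civita_connection (pkn_levi_civita MP).

Let c := coords i \o gamma.
Let f := coords (i : chart (tangent_bundle M)) \o Gamma.
(** Smoothness of the curve is given chart by chart, so derivatives are taken at parameters of this
    open set. *)
Let S := J `&` Gamma @^-1` dom (i : chart (tangent_bundle M)).

Let oS : open S.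
Proof.
by have [_ + _] := GammaP; apply; exact: mopen_tangent_chart (pkn_manifold MP) i.
Qed.

Let nearS t : S t -> \forall s \near t, S s.
Proof. by move=> tS; apply: open_nbhs_nbhs. Qed.

Let f_diff t : S t -> differentiable f t.
Proof. by move=> tS; have [_ _ /(_ i 1)[+ _]] := GammaP; apply. Qed.

Let df_diff t : S t -> differentiable (derive1 f) t.
Proof.
move=> tS; have [_ _ /(_ i 2)[_ /(_ 1)[+ _]]] := GammaP => /(_ t tS).
by apply: near_eq_differentiable; near=> s; rewrite derive1E.
Unshelve. all: by end_near. Qed.

Let c_diff t : S t -> differentiable c t.
Proof. by move=> tS; exact: (differentiable_fst_curve (f_diff tS)). Qed.

Let xi_diff t : S t -> differentiable (xi i) t.
Proof. by move=> tS; exact: (differentiable_snd_curve (f_diff tS)). Qed.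

Lemma velocity_tangent_bundle t : S t ->
  velocity Gamma i t = (gamma' i t, derive1 (xi i) t).
Proof. by move=> tS; exact: (derive1_pair (f_diff tS)). Qed.

Lemma vpart_velocity t : S t ->
  vpart nabla i (f t) (velocity Gamma i t) = xi' i t.
Proof. by move=> tS; rewrite velocity_tangent_bundle. Qed.

(** The components of the velocity are identified on [S]; as [S] is open, this suffices to
    differentiate once more. *)
Let fst_near t : S t -> {near t, (fun s => (derive1 f s).1) =1 gamma' i}.
Proof.
move=> tS; near=> s; rewrite -[derive1 f s]/(velocity Gamma i s).
by rewrite velocity_tangent_bundle//; near: s; exact: nearS.
Unshelve. all: by end_near. Qed.

Let snd_near t : S t -> {near t, (fun s => (derive1 f s).2) =1 derive1 (xi i)}.
Proof.
move=> tS; near=> s; rewrite -[derive1 f s]/(velocity Gamma i s).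
by rewrite velocity_tangent_bundle//; near: s; exact: nearS.
Unshelve. all: by end_near. Qed.

Let gamma'_diff t : S t -> differentiable (gamma' i) t.
Proof.
move=> tS; apply: near_eq_differentiable (fst_near tS) _.
exact: differentiable_fst_curve (df_diff tS).
Qed.

Let dxi_diff t : S t -> differentiable (derive1 (xi i)) t.
Proof.
move=> tS; apply: near_eq_differentiable (snd_near tS) _.
exact: differentiable_snd_curve (df_diff tS).
Qed.

Lemma derive1_velocity_tangent_bundle t : S t ->
  derive1 (velocity Gamma i) t =
  (derive1 (gamma' i) t, derive1 (derive1 (xi i)) t).
Proof.
move=> tS; rewrite -[velocity Gamma i]/(derive1 f) (derive1_pair (df_diff tS)).
by rewrite !derive1E; congr pair;
  [exact: near_eq_derive (fst_near tS)|exact: near_eq_derive (snd_near tS)].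
Qed.

Let zT t : S t -> image_of (M := tangent_bundle M) i (f t).
Proof. by move=> [_ ti]; exists (Gamma t). Qed.

Let xU t : S t -> image_of i (c t).
Proof. by move=> tS; exact: (image_of_tangent_bundle (zT tS)). Qed.

(** The symbol part of [xi'] depends on the parameter through the base point, [gamma'] and [xi];
    [derive1_along] differentiates it. *)
Let cov_xi' t : S t -> cov_along nabla gamma xi' i t =
  derive1 (derive1 (xi i)) t
  + ('D_(gamma' i t) (fun y => nabla i y (gamma' i t) (xi i t)) (c t)
  + nabla i (c t) (derive1 (gamma' i) t) (xi i t)
  + nabla i (c t) (gamma' i t) (derive1 (xi i) t))
  + nabla i (c t) (gamma' i t) (xi' i t).
Proof.
move=> tS; rewrite {1}/cov_along; congr (_ + _).
have nU : \forall y \near c t, image_of i y.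
  apply: open_nbhs_nbhs; split; last exact: xU.
  exact: open_image_of (pkn_manifold MP).
have lr : \forall y \near c t, forall a, linear (nabla i y a).
  by apply: filterS nU => y yU a; exact: (connection_linearr nablaP).
have ll : \forall y \near c t, forall b, linear (nabla i y ^~ b).
  by apply: filterS nU => y yU b; exact: (connection_linearl nablaP).
have nd a b : differentiable (fun y => nabla i y a b) (c t).
  by apply: (connection_differentiable (pkn_levi_civita MP)); exact: xU.
have [dn nE] := derive1_along lr ll nd (c_diff tS) (gamma'_diff tS) (xi_diff tS).
rewrite -[derive1 c t]/(gamma' i t) in nE; rewrite -nE !derive1E.
exact: (deriveD (diff_derivable (dxi_diff tS)) dn).
Qed.

(** With the symbols evaluated on the velocity, the second derivatives of the coordinates complete
    nabla(p, p) to gamma'' and the vertical terms to the expansion of xi''. *)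
Lemma cov_along_velocity_tangent_bundle t
    (a := cov_along nablaT Gamma (velocity Gamma) i t) : S t ->
  a.1 = cov_along nabla gamma gamma' i t
    - curvature nabla i (c t) (xi' i t) (phi i (c t) (xi i t)) (gamma' i t) /\
  vpart nabla i (f t) a = cov_along nabla gamma xi' i t.
Proof.
move=> tS.
have [] := sasaki_symbols MP lcT (zT tS) (velocity Gamma i t).
rewrite vpart_velocity// velocity_tangent_bundle// => n1 n2.
have -> : a = (derive1 (gamma' i) t, derive1 (derive1 (xi i)) t) +
    nablaT i (f t) (gamma' i t, derive1 (xi i) t) (gamma' i t, derive1 (xi i) t).
  by rewrite -derive1_velocity_tangent_bundle// -velocity_tangent_bundle.
split; first by rewrite /= n1 addrA.
rewrite (is_linearD (vpart_linear nablaP (z := f t) (xU tS))) n2 cov_xi'//.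
rewrite /vpart /= -[coords i _]/(c t) -[(Gamma t).2 i]/(xi i t).
by rewrite -!addrA; congr (_ + _); rewrite [LHS]addrCA.
Qed.

End Curve.

(** * Comparison of horizontal and vertical parts, and planar curves *)

Lemma eq_lift_parts (R : realType) (E : normedModType R) (M : atlas E)
    (nabla : symbols M) (i : chart M) (z a b : E * E) :
  a.1 = b.1 -> vpart nabla i z a = vpart nabla i z b -> a = b.
Proof.
by move=> ab1 abv; rewrite (lift_decomp nabla i z a) ab1 abv -lift_decomp.
Qed.

Lemma vpart_hlift11 (R : realType) (E : normedModType R) (M : atlas E)
    (nabla : symbols M) (F : field11 M) (i : chart M) (z a : E * E) :
  connection nabla -> image_of i z.1 ->
  vpart nabla i z (hlift11 nabla F i z a) = F i z.1 (vpart nabla i z a).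
Proof.
move=> nablaP zU; rewrite /hlift11 (is_linearD (vpart_linear nablaP zU)).
by rewrite vpart_hlift add0r (vpart_vlift nablaP).
Qed.

Theorem theorem5p1 (R : realType) (m : nat)
    (M : atlas 'rV[R]_(2 * m)%N)
    (phi F : field11 M) (g : field02 M) (nabla : symbols M)
    (nablaT : symbols (tangent_bundle M))
    (J : set R) (Gamma : R -> mpoint (tangent_bundle M)) :
  para_kahler_norden phi g nabla ->
  levi_civita (phi_sasaki nabla phi g) nablaT ->
  tensor11 F ->
  open J -> is_interval J -> smooth_curve J Gamma ->
  let gamma := base_curve Gamma in
  let xi := fibre_field Gamma in
  let gamma' := velocity gamma in
  let gamma'' := cov_along nabla gamma gamma' in
  let xi' := cov_along nabla gamma xi in
  let xi'' := cov_along nabla gamma xi' in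
  planar nablaT (hlift11 nabla F) J Gamma <->
  exists rho1 rho2 : R -> R,
    forall t, J t -> forall i : chart M, dom i (gamma t) ->
      let x := coords i (gamma t) in
      gamma'' i t =
        curvature nabla i x (xi' i t) (phi i x (xi i t)) (gamma' i t)
        + rho1 t *: gamma' i t + rho2 t *: F i x (gamma' i t) /\
      xi'' i t = rho1 t *: xi' i t + rho2 t *: F i x (xi' i t).
Proof.
move=> MP lcT _ _ _ GammaP gamma xi gamma' gamma'' xi' xi''.
have nablaP := levi_civita_connection (pkn_levi_civita MP).
(* A chart of the bundle contains (p, v) only if v is tangent at p; the carrier condition on the
   curve provides this. *)
have tangentP t : J t -> tangent (gamma t) (Gamma t).2.
  by have [+ _ _] := GammaP => /[apply] -[i []].
(* The equivalence holds for fixed multipliers, parameter and chart, so the same two functions serve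
   in both directions. *)
have step rho1 rho2 t i : J t -> dom i (gamma t) ->
    (cov_along nablaT Gamma (velocity Gamma) i t =
      rho1 *: velocity Gamma i t + rho2 *: hlift11 nabla F i
        (coords (i : chart (tangent_bundle M)) (Gamma t)) (velocity Gamma i t)) <->
    (gamma'' i t = curvature nabla i (coords i (gamma t)) (xi' i t)
        (phi i (coords i (gamma t)) (xi i t)) (gamma' i t)
      + rho1 *: gamma' i t + rho2 *: F i (coords i (gamma t)) (gamma' i t) /\
    xi'' i t = rho1 *: xi' i t + rho2 *: F i (coords i (gamma t)) (xi' i t)).
  move=> Jt ti; have St : (J `&` Gamma @^-1` dom (i : chart (tangent_bundle M))) t.
    by split=> //; split=> //; exact: tangentP.
  have xU : image_of i (coords i (gamma t)) by exists (gamma t).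
  set z := coords _ (Gamma t).
  have [a1 av] := cov_along_velocity_tangent_bundle MP lcT GammaP St.
  have vl := vpart_linear nablaP (z := z) xU.
  have b1 : (rho1 *: velocity Gamma i t
      + rho2 *: hlift11 nabla F i z (velocity Gamma i t)).1 =
      rho1 *: gamma' i t + rho2 *: F i (coords i (gamma t)) (gamma' i t).
    by rewrite /= addr0 (velocity_tangent_bundle GammaP St).
  have bv : vpart nabla i z (rho1 *: velocity Gamma i t
      + rho2 *: hlift11 nabla F i z (velocity Gamma i t)) =
      rho1 *: xi' i t + rho2 *: F i (coords i (gamma t)) (xi' i t).
    rewrite (is_linearD vl) !(is_linearZ vl) vpart_hlift11//.
    by rewrite (vpart_velocity nabla GammaP St).
  split=> [ab|[h1 h2]].
    split; last by rewrite -bv -ab av.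
    by rewrite -[RHS]addrA -b1 -ab a1 [RHS]addrC; exact: esym (subrK _ _).
  apply: (@eq_lift_parts _ _ _ nabla i z); last by rewrite av bv.
  rewrite a1 b1; apply/eqP; rewrite subr_eq; apply/eqP.
  by rewrite [RHS]addrC addrA.
split=> -[rho1 [rho2 h]]; exists rho1, rho2 => t Jt i ti.
  by apply/step => //; apply: h => //; split=> //; exact: tangentP.
by case: ti => ti _; apply/step => //; exact: h.
Qed.
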